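(* Let $n \ge 1$, let $s_1,\dots,s_n$ be positive integers with $s_1 \mid s_j$ for all $1\le j\le n$, and let $G=\mathbb{H}(s_1,s_2,\ldots,s_n)$. Let $(\rho,V)$ be an irreducible monomial complex representation of $G$ with respect to $(H(V),\chi)$, that is, $V\cong \mathrm{Ind}_{H(V)}^G(\chi)$ for a subgroup $H(V)$ of $G$ and a character $\chi: H(V)\to\mathbb{C}^\times$. Let $N_1$ be a positive integer and, for all $1\le j\le n$, let $N_j$ be the least positive integer such that $\frac{N_j s_j}{s_1}$ is a multiple of $N_1$. Then the following are equivalent. (1) $\chi|_{[G,G]}$ has (finite) order $N_1$. (2) $V$ is finite dimensional and $\dim(V)=N_1N_2\cdots N_n$.
   Context: $\mathbb{H}(s_1,\ldots,s_n)=\{(u,v,z)\mid z\in\mathbb{Z},\ u,v\in\mathbb{Z}^n\}$ is the group with operation $(u,v,z)(u',v',z')=(u+u',\,v+v',\,z+z'+\sum_{i=1}^n s_iu_iv_i')$. Its commutator subgroup is $[G,G]=\{(\mathbf{0},\mathbf{0},s_1z)\mid z\in\mathbb{Z}\}$, which is central; when $\mathrm{Ind}_{H(V)}^G(\chi)$ is irreducible, $H(V)$ contains the center of $G$, so $\chi|_{[G,G]}$ is defined. Representations are homomorphisms $G\to\mathrm{Aut}(V)$ with $V$ a complex vector space, possibly infinite dimensional; a character is a homomorphism to $\mathbb{C}^\times$; the order of a character is the least positive integer $m$ (if any) such that its $m$-th power is trivial. For a subgroup $H$ of $G$ and a character $\chi$ of $H$, $\mathrm{Ind}_H^G(\chi)$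 is the space of functions $f: G\to\mathbb{C}$ such that $f(hg)=\chi(h)f(g)$ for all $h\in H$, $g\in G$, with support contained in a union of finitely many right cosets $Hg$; $G$ acts by $(g\cdot f)(x)=f(xg)$. *)

(* Defs.v *)
From HB Require Import structures.
From mathcomp Require Import all_boot all_order all_algebra.
From mathcomp Require Import complex ring.
From mathcomp Require Import boolp classical_sets functions reals.

Set Implicit Arguments.
Unset Strict Implicit.
Unset Printing Implicit Defensive.

Import Order.TTheory GRing.Theory Num.Theory.

Local Open Scope classical_set_scope.
Local Open Scope ring_scope.

Definition is_least_pos (P : nat -> Prop) (m : nat) : Prop :=
  [/\ (0 < m)%N, P m & forall k : nat, (0 < k)%N -> P k -> (m <= k)%N].

Section Groups.
Variable G : groupType.

(* The [set]-valued form of [group_closed]. *)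
Definition is_subgroup (H : set G) : Prop :=
  H 1%g /\ forall x y : G, H x -> H y -> H (x / y)%g.

Definition commutator_subgroup : set G :=
  smallest is_subgroup [set c | exists x y : G, c = [~ x, y]%g].

Definition right_coset (H : set G) (g : G) : set G :=
  [set (h * g)%g | h in H].

End Groups.

Arguments commutator_subgroup : clear implicits.

Section Representations.
Variables (C : fieldType) (G : groupType).

(* Multiplicativity and [rep1] make each [rep_fun g] invertible, with inverse
   [rep_fun g^-1], so this is a homomorphism from [G] to [Aut(V)]. *)
Record representation (V : lmodType C) := Representation {
  rep_fun :> G -> {linear V -> V};
  rep1 : forall v : V, rep_fun 1%g v = v;
  repM : forall (g h : G) (v : V), rep_fun (g * h)%g v = rep_fun g (rep_fun h v)
}.

(* The [set]-valued form of [submod_closed]. *)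
Definition is_subspace (V : lmodType C) (W : set V) : Prop :=
  W 0 /\ forall (a : C) (u v : V), W u -> W v -> W (a *: u + v).

Definition irreducible (V : lmodType C) (rho : representation V) : Prop :=
  (exists v : V, v != 0) /\
  forall W : set V, is_subspace W ->
    (forall (g : G) (v : V), W v -> W (rho g v)) ->
    W = [set 0] \/ W = setT.

Definition rep_isomorphic (V W : lmodType C)
    (rho : representation V) (sigma : representation W) : Prop :=
  exists phi : {linear V -> W}, bijective phi /\
    forall (g : G) (v : V), phi (rho g v) = sigma g (phi v).

Definition has_dimension (V : lmodType C) (d : nat) : Prop :=
  exists e : 'I_d -> V,
    (forall c : 'I_d -> C, \sum_i c i *: e i = 0 -> forall i, c i = 0) /\
    (forall v : V, exists c : 'I_d -> C, v = \sum_i c i *: e i).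

(* A character of a subgroup [H] is carried by a function on all of [G]; its
   values outside [H] are irrelevant. *)
Definition is_character (H : set G) (chi : G -> C) : Prop :=
  (forall h : G, H h -> chi h != 0) /\
  (forall h k : G, H h -> H k -> chi (h * k)%g = chi h * chi k).

(* Meaningful when [chi] is a character of a subgroup [H] containing [K].  For
   [K] the commutator subgroup of a Heisenberg group this inclusion is not
   assumed: it holds as soon as the representation induced from [(H, chi)] is
   irreducible, because [H] then contains the center. *)
Definition restriction_has_order (K : set G) (chi : G -> C) (m : nat) : Prop :=
  is_least_pos (fun k : nat => forall x : G, K x -> chi x ^+ k = 1) m.

Section Induced.
Variables (H : set G) (chi : G -> C).

Definition in_ind (f : G -> C^o) : Prop :=
  (forall h g : G, H h -> f (h * g)%g = chi h * f g) /\
  exists s : seq G,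
    [set x | f x != 0] `<=` \bigcup_(g in [set` s]) right_coset H g.

Definition ind_pred : {pred G -> C^o} := fun f => `[< in_ind f >].

Lemma ind_submod_closed : submod_closed ind_pred.
Proof.
split.
  apply/asboolP; split=> [h g _|]; first by rewrite mulr0.
  by exists [::] => x /=; rewrite eqxx.
move=> a f g /asboolP [fH [s sf]] /asboolP [gH [t tg]].
apply/asboolP; split=> [h x Hh|].
  change (a * f (h * x)%g + g (h * x)%g = chi h * (a * f x + g x)).
  by rewrite fH // gH // mulrDr mulrCA.
exists (s ++ t) => x /= fgx.
have [fx0|/sf [y /= sy xy]] := eqVneq (f x) 0; last first.
  by exists y => //=; rewrite mem_cat sy.
have /tg [y /= ty xy] : g x != 0.
  apply: contra_neq fgx => gx0.
  by change (a * f x + g x = 0); rewrite fx0 gx0 mulr0 addr0.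
by exists y => //=; rewrite mem_cat ty orbT.
Qed.

HB.instance Definition _ :=
  GRing.isSubmodClosed.Build C (G -> C^o) ind_pred ind_submod_closed.

Record ind_space := IndSpace { ind_val :> G -> C^o; _ : ind_val \in ind_pred }.

HB.instance Definition _ := [isSub for ind_val].
HB.instance Definition _ := [Choice of ind_space by <:].
HB.instance Definition _ := [SubChoice_isSubLmodule of ind_space by <:].

Lemma ind_act_subproof (g : G) (f : ind_space) :
  (fun x : G => f (x * g)%g) \in ind_pred.
Proof.
case: f => f /= /asboolP [fH [s sf]]; apply/asboolP; split=> [h x Hh|].
  by rewrite -mulgA; apply: fH.
exists [seq (y * g^-1)%g | y <- s] => x /= /sf [y /= sy [h Hh hy]].
exists (y * g^-1)%g => /=; first by apply/mapP; exists y.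
by exists h => //; rewrite mulgA hy mulgK.
Qed.

Definition ind_act (g : G) (f : ind_space) : ind_space :=
  IndSpace (ind_act_subproof g f).

Lemma ind_act_linear (g : G) : linear (ind_act g).
Proof. by move=> a u v; apply/val_inj/funext. Qed.

HB.instance Definition _ (g : G) :=
  GRing.isLinear.Build C ind_space ind_space *:%R (ind_act g)
    (ind_act_linear g).

Lemma ind_act1 (f : ind_space) : ind_act 1%g f = f.
Proof. by apply/val_inj/funext => x /=; rewrite mulg1. Qed.

Lemma ind_actM (g h : G) (f : ind_space) :
  ind_act (g * h)%g f = ind_act g (ind_act h f).
Proof. by apply/val_inj/funext => x /=; rewrite mulgA. Qed.

Definition ind_rep : representation ind_space :=
  @Representation ind_space (fun g => ind_act g) ind_act1 ind_actM.

End Induced.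

Definition monomial_wrt (V : lmodType C) (rho : representation V)
    (H : set G) (chi : G -> C) : Prop :=
  [/\ is_subgroup H, is_character H chi & rep_isomorphic rho (ind_rep H chi)].

End Representations.

(* [s] is a phantom parameter: it only selects the group law. *)
Record heisenberg (n : nat) (s : 'I_n -> nat) := Heisenberg {
  hu : 'rV[int]_n;
  hv : 'rV[int]_n;
  hz : int
}.

Arguments Heisenberg {n s}.

Section Heisenberg.
Variables (n : nat) (s : 'I_n -> nat).

Local Notation heisenberg := (heisenberg s).

Definition heis_to_prod (x : heisenberg) := (hu x, hv x, hz x).
Definition prod_to_heis (p : 'rV[int]_n * 'rV[int]_n * int) : heisenberg :=
  Heisenberg p.1.1 p.1.2 p.2.

Lemma heis_to_prodK : cancel heis_to_prod prod_to_heis.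
Proof. by case. Qed.

HB.instance Definition _ := Choice.copy heisenberg (can_type heis_to_prodK).

Definition heis_form (u v : 'rV[int]_n) : int :=
  \sum_i (s i)%:Z * u 0 i * v 0 i.

Definition heis_mul (x y : heisenberg) : heisenberg :=
  Heisenberg (hu x + hu y) (hv x + hv y)
    (hz x + hz y + heis_form (hu x) (hv y)).

Definition heis_one : heisenberg := Heisenberg 0 0 0.

Definition heis_inv (x : heisenberg) : heisenberg :=
  Heisenberg (- hu x) (- hv x) (- hz x + heis_form (hu x) (hv x)).

Lemma heis_formDl u u' v :
  heis_form (u + u') v = heis_form u v + heis_form u' v.
Proof.
by rewrite -big_split; apply: eq_bigr => i _; rewrite mxE mulrDr mulrDl.
Qed.

Lemma heis_formDr u v v' :
  heis_form u (v + v') = heis_form u v + heis_form u v'.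
Proof. by rewrite -big_split; apply: eq_bigr => i _; rewrite mxE mulrDr. Qed.

Lemma heis_form0l v : heis_form 0 v = 0.
Proof. by apply: big1 => i _; rewrite mxE mulr0 mul0r. Qed.

Lemma heis_form0r u : heis_form u 0 = 0.
Proof. by apply: big1 => i _; rewrite mxE mulr0. Qed.

Lemma heis_formNl u v : heis_form (- u) v = - heis_form u v.
Proof.
by apply/eqP; rewrite -addr_eq0 -heis_formDl addNr heis_form0l.
Qed.

Lemma heis_formNr u v : heis_form u (- v) = - heis_form u v.
Proof.
by apply/eqP; rewrite -addr_eq0 -heis_formDr addNr heis_form0r.
Qed.

Lemma heis_mulA : associative heis_mul.
Proof.
move=> x y z; rewrite /heis_mul /=; congr Heisenberg; rewrite ?addrA //.
by rewrite heis_formDl heis_formDr; ring.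
Qed.

Lemma heis_mul1 : left_id heis_one heis_mul.
Proof. by case=> u v z; rewrite /heis_mul /= !add0r heis_form0l addr0. Qed.

Lemma heis_mulr1 : right_id heis_one heis_mul.
Proof. by case=> u v z; rewrite /heis_mul /= !addr0 heis_form0r addr0. Qed.

Lemma heis_mulV : left_inverse heis_one heis_inv heis_mul.
Proof.
case=> u v z; rewrite /heis_mul /heis_inv /heis_one /= !addNr heis_formNl.
by rewrite addrAC addrK addNr.
Qed.

Lemma heis_mulrV : right_inverse heis_one heis_inv heis_mul.
Proof.
case=> u v z; rewrite /heis_mul /heis_inv /heis_one /= !subrr heis_formNr.
by rewrite addrA subrr add0r subrr.
Qed.

End Heisenberg.

HB.instance Definition _ (n : nat) (s : 'I_n -> nat) :=
  isGroup.Build (heisenberg s) (@heis_mulA n s) (@heis_mul1 n s)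
    (@heis_mulr1 n s) (@heis_mulV n s) (@heis_mulrV n s).

(* Main.v *)
From HB Require Import structures.
Require Import Defs.
From mathcomp Require Import all_boot all_order all_algebra.
From mathcomp Require Import complex ring zify.
From mathcomp Require Import boolp classical_sets reals.

(** Write [psi] for the character of the centre obtained by restricting [chi]
and [omega (g, h)] for the central coordinate of the commutator of [g] and [h],
an alternating biadditive form with values in the multiples of [s ord0].

The engine is Mackey's observation on intertwiners ([irr_stabilizer]): if the representation induced from [(H, chi)] is
irreducible, then [H] contains every [g] whose conjugation preserves [H] and
[chi].  For such a [g], left translation by [g] is an endomorphism [T] of the
induced representation; if [g] were outside [H], then either [T] would have an
eigenvalue without being a scalar, or [T - 1] would be non-zero without being
onto, and both contradict irreducibility.

Applied to a Heisenberg group this says that [H] contains the centre and is its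
own orthogonal for the pairing [psi (omega (g, h))] ([subgroup_perp]).  If [psi]
has order [N] on the commutator subgroup, which is generated by the central
element with coordinate [s ord0], the pairing descends to the finite group of
pairs of vectors modulo [N].  There [H] becomes a subgroup [S] equal to its own
orthogonal, and summing the pairing over all [(a, b)] with [b] in [S], in both
orders, gives [|S|^2 = |A| |Rad|], where [Rad] is the radical
([lagrangian_transversal]).  Hence the index [d] of [H] satisfies
[d^2 |Rad| = |A|].  The radical is cut out coordinate by coordinate by the
divisibility by [N / gcd (N, s_j / s_0)], which is the [N_j] of the theorem, so
[d] is the product of the [N_j].  The index is the dimension, a basis of the
induced space being given by one function supported on each coset
([ind_dim]), which settles the forward implication.

Conversely a finite dimension bounds the number of cosets, so that powers
[x^k] and [y^l] of two elements with [omega (x, y) = s ord0] lie in [H]; as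
[chi] is multiplicative on [H], [psi] takes the value [1] at [s ord0 * k * l]
and thus has some finite order [M] on the commutator subgroup.  By the first
part the dimension is the product of the [M / gcd (M, s_j / s_0)].  This
product determines [M]: the exponent of each prime in it is a strictly
increasing function of the exponent of that prime in [M]
([prod_div_gcd_inj]). *)

Set Implicit Arguments.
Unset Strict Implicit.
Unset Printing Implicit Defensive.

Import Order.TTheory GRing.Theory Num.Theory.

(** * Linear algebra and transport along isomorphisms *)

Section LinearAlgebra.
Local Open Scope ring_scope.

(** More vectors than generators give a coefficient matrix with more rows than
columns, whose row kernel contains a non-trivial relation. *)
Lemma has_dimension_free (C : fieldType) (V : lmodType C) (d m : nat)
    (w : 'I_m -> V) :
  has_dimension V d ->
  (forall c : 'I_m -> C, \sum_i c i *: w i = 0 -> forall i, c i = 0) ->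
  (m <= d)%N.
Proof.
move=> [e [_ e_gen]] w_free; rewrite leqNgt; apply/negP => d_lt_m.
have [a wE] := choice (fun i => e_gen (w i)).
pose A : 'M[C]_(m, d) := \matrix_(i, j) a i j.
have: kermx A != 0.
  rewrite -mxrank_eq0 mxrank_ker subn_eq0 -ltnNge.
  exact: leq_ltn_trans (rank_leq_col A) d_lt_m.
case/rowV0Pn => x /sub_kermxP xA0; apply/negP; rewrite negbK.
apply/eqP/rowP => i; rewrite mxE; apply: (w_free (fun i => x 0 i)).
under eq_bigr => k _ do rewrite wE scaler_sumr.
rewrite exchange_big big1 //= => j _.
under eq_bigr => k _ do rewrite scalerA.
rewrite -scaler_suml; move/rowP/(_ j): xA0; rewrite !mxE => xA0.
rewrite (_ : \sum_i _ = 0) ?scale0r // -[RHS]xA0.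
by apply: eq_bigr => k _; rewrite mxE.
Qed.

Lemma has_dimension_inj (C : fieldType) (V : lmodType C) (d d' : nat) :
  has_dimension V d -> has_dimension V d' -> d = d'.
Proof.
move=> Vd Vd'; apply/eqP; rewrite eqn_leq; apply/andP; split.
  by have [e [e_free _]] := Vd; apply: has_dimension_free Vd' e_free.
by have [e [e_free _]] := Vd'; apply: has_dimension_free Vd e_free.
Qed.

Lemma has_dimension_iso (C : fieldType) (V W : lmodType C)
    (phi : {linear V -> W}) (d : nat) :
  bijective phi -> has_dimension V d -> has_dimension W d.
Proof.
move=> [psi phiK psiK] [e [e_free e_gen]]; exists (phi \o e); split=> [c|w].
  move=> c0; apply: e_free; apply: (can_inj phiK).
  by rewrite linear0 -c0 linear_sum; apply: eq_bigr => i _; rewrite linearZ.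
have [c cE] := e_gen (psi w); exists c; rewrite -[LHS]psiK cE linear_sum.
by apply: eq_bigr => i _; rewrite linearZ.
Qed.

Lemma rep_isomorphic_sym (C : fieldType) (G : groupType) (V W : lmodType C)
    (rho : representation G V) (sigma : representation G W) :
  rep_isomorphic rho sigma -> rep_isomorphic sigma rho.
Proof.
move=> [phi [[psi phiK psiK] phiE]].
have psi_lin : linear psi by exact: (can2_linear phiK psiK).
pose psiL := HB.pack psi (GRing.isLinear.Build C W V *:%R psi psi_lin)
  : {linear W -> V}.
exists psiL; split=> [|g w]; first by exists phi.
by apply: (can_inj phiK); rewrite phiE !psiK.
Qed.

Lemma irreducible_iso (C : fieldType) (G : groupType) (V W : lmodType C)
    (rho : representation G V) (sigma : representation G W) :
  rep_isomorphic rho sigma -> irreducible rho -> irreducible sigma.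
Proof.
move=> [phi [[psi phiK psiK] phiE]] [[v v0] rho_irr]; split.
  exists (phi v); apply: contra_neq v0 => /(canRL phiK) ->.
  by rewrite -(linear0 phi) phiK.
move=> U [U0 UL] Uinv.
have [||U0'|U1] := rho_irr (phi @^-1` U)%classic.
- split=> /=; rewrite ?linear0 // => a x y Ux Uy.
  by rewrite linearP; apply: UL.
- by move=> g x /= Ux; rewrite phiE; apply: Uinv.
- left; apply/seteqP; split=> [w Uw|w /= ->] //.
  have : (phi @^-1` U)%classic (psi w) by rewrite /= psiK.
  by rewrite U0' /= => w0; rewrite -[w]psiK w0 linear0.
- right; apply/seteqP; split=> // w _; rewrite -[w]psiK.
  by have : [set: V]%classic (psi w) by []; rewrite -U1.
Qed.
End LinearAlgebra.

(** * Induced representations *)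

Section Subgroup.
Local Open Scope group_scope.
Variables (G : groupType) (H : set G).
Hypothesis Hgrp : is_subgroup H.

Lemma subg1 : H 1. Proof. exact: Hgrp.1. Qed.

Lemma subgV x : H x -> H x^-1.
Proof. by move=> Hx; rewrite -[x^-1]mul1g; apply: Hgrp.2 => //; apply: subg1. Qed.

Lemma subgVr x : H x^-1 -> H x.
Proof. by move/subgV; rewrite invgK. Qed.

Lemma subgM x y : H x -> H y -> H (x * y).
Proof. by move=> Hx /subgV Hy; rewrite -[y]invgK; apply: Hgrp.2. Qed.

Lemma subgMl x y : H x -> H (x * y) -> H y.
Proof. by move=> Hx Hxy; rewrite -(mulKg x y); apply: subgM => //; apply: subgV. Qed.

Lemma subg_div_trans x y z : H (x / y) -> H (y / z) -> H (x / z).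
Proof. by move=> Hxy Hyz; rewrite -[x](mulgVK y) -mulgA; apply: subgM. Qed.

Lemma subg_div_sym x y : H (x / y) -> H (y / x).
Proof. by move/subgV; rewrite invgM invgK. Qed.
End Subgroup.

Section Induced.
Local Open Scope ring_scope.
Variables (C : fieldType) (G : groupType) (H : set G) (chi : G -> C).
Hypothesis Hgrp : is_subgroup H.
Hypothesis chi_char : is_character H chi.

Lemma chi1 : chi 1%g = 1.
Proof.
have H1 := subg1 Hgrp; apply: (mulfI (chi_char.1 _ H1)).
by rewrite -chi_char.2 // mulg1 mulr1.
Qed.

Lemma ind_valP (f : ind_space H chi) : in_ind H chi f.
Proof. by case: f => f /= /asboolP. Qed.

Lemma ind_valM (f : ind_space H chi) (h x : G) :
  H h -> f (h * x)%g = chi h * f x.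
Proof. by case: (ind_valP f) => fM _; apply: fM. Qed.

Lemma ind_eqP (f g : ind_space H chi) : (forall x, f x = g x) -> f = g.
Proof. by move=> fg; apply/val_inj/funext. Qed.

Lemma ind_sumE (I : finType) (F : I -> ind_space H chi) x :
  (\sum_i F i) x = \sum_i F i x.
Proof. exact: (big_morph (fun f : ind_space H chi => f x)). Qed.

(** Up to scaling, the only function of the induced space supported on the
coset [H t]. *)
Definition coset_fun (t x : G) : C^o :=
  if `[< H (x / t)%g >] then chi (x / t)%g else 0.

Lemma coset_fun_in_ind (t : G) : coset_fun t \in ind_pred H chi.
Proof.
apply/asboolP; split=> [h x Hh|].
  rewrite /coset_fun; case: asboolP => [Hhx|nHhx]; case: asboolP => [Hx|nHx].
  - by rewrite -mulgA (chi_char.2 _ _ Hh Hx).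
  - by case: nHx; apply: (subgMl Hgrp Hh); rewrite mulgA.
  - by case: nHhx; rewrite -mulgA; apply: subgM.
  - by rewrite mulr0.
exists [:: t] => x /=; rewrite /coset_fun.
case: asboolP => [Hx _|_]; last by rewrite eqxx.
by exists t; rewrite /= ?mem_seq1 //; exists (x / t)%g; rewrite // mulgVK.
Qed.

Definition ind_coset (t : G) : ind_space H chi := IndSpace (coset_fun_in_ind t).

Lemma ind_coset_id t : ind_coset t t = 1.
Proof. by rewrite /= /coset_fun mulgV chi1; case: asboolP => // -[]; exact: subg1. Qed.

Lemma ind_coset_out t x : ~ H (x / t)%g -> ind_coset t x = 0.
Proof. by rewrite /= /coset_fun; case: asboolP. Qed.

(** Pigeonhole: infinitely many points of the support of [f] are spread over
finitely many cosets. *)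
Lemma ind_finite_support (f : ind_space H chi) (t : nat -> G) :
  (forall i, f (t i) != 0) -> exists i j, (i < j)%N /\ H (t j / t i)%g.
Proof.
move=> ft; have [_ [s sP]] := ind_valP f.
have /choice [y yP] : forall i, exists y, y \in s /\ H (t i / y)%g.
  move=> i; have [y /= ys [h Hh hy]] := sP (t i) (ft i).
  by exists y; split=> //; rewrite -hy mulgK.
pose q (i : 'I_(size s).+1) : 'I_(size s) :=
  Ordinal (etrans (index_mem _ _) (yP i).1).
have /injectivePn [i [j ij qij]] : ~~ injectiveb q.
  apply/negP => /injectiveP /leq_card; rewrite !card_ord ltnn //.
have yij : y i = y j.
  by rewrite -(nth_index 1%g (yP i).1) -(nth_index 1%g (yP j).1); case: qij => ->.
have Hij : H (t i / t j)%g.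
  apply: (subg_div_trans Hgrp (yP i).2); rewrite yij.
  by apply: subg_div_sym => //; exact: (yP j).2.
case: (ltngtP i j) => [lt_ij|lt_ji|/val_inj eq_ij]; last by rewrite eq_ij eqxx in ij.
- by exists i, j; split=> //; apply: subg_div_sym.
- by exists j, i.
Qed.

Lemma ind_coset_free (m : nat) (t : 'I_m -> G) :
  (forall i j, H (t i / t j)%g -> i = j) ->
  forall c : 'I_m -> C, \sum_i c i *: ind_coset (t i) = 0 -> forall i, c i = 0.
Proof.
move=> t_inj c c0 i.
have : (\sum_j c j *: ind_coset (t j)) (t i) = 0 by rewrite c0.
rewrite ind_sumE (bigD1 i) //= big1 ?addr0.
  by change (c i * ind_coset (t i) (t i) = 0 -> c i = 0); rewrite ind_coset_id mulr1.
move=> j ji; change (c j * ind_coset (t j) (t i) = 0); rewrite ind_coset_out ?mulr0 //.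
by move=> /t_inj ij; rewrite ij eqxx in ji.
Qed.

(** The dimension is the index: an equivariant function is determined by its
values on a system of representatives of the cosets. *)
Lemma ind_dim (d : nat) (t : 'I_d -> G) :
  (forall i j, H (t i / t j)%g -> i = j) ->
  (forall x, exists i, H (x / t i)%g) ->
  has_dimension (ind_space H chi) d.
Proof.
move=> t_inj t_sur; exists (ind_coset \o t); split; first exact: ind_coset_free.
move=> f; exists (fun i => f (t i)); apply: ind_eqP => x; rewrite ind_sumE.
have [i Hi] := t_sur x; rewrite (bigD1 i) //= big1 ?addr0; last first.
  move=> j ji; change (f (t j) * ind_coset (t j) x = 0).
  rewrite ind_coset_out ?mulr0 // => Hj; move: ji; rewrite -(t_inj i j) ?eqxx //.
  by apply: (subg_div_trans Hgrp _ Hj); apply: subg_div_sym.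
change (f x = f (t i) * coset_fun (t i) x); rewrite /coset_fun asboolT //.
by rewrite -{1}(mulgVK (t i) x) ind_valM // mulrC.
Qed.

(** When [g] stabilizes [(H, chi)], left translation by [g] preserves the
equivariance condition, and it commutes with the action of [G], which is by
right translation. *)
Section LeftTranslation.
Variable g : G.
Hypothesis g_norm : forall h, H h -> H (g * h / g)%g /\ chi (g * h / g)%g = chi h.
Hypothesis gV_norm : forall h, H h -> H (g^-1 * h * g)%g.

Lemma ind_ltrans_in_ind (f : ind_space H chi) :
  (fun x => f (g * x)%g) \in ind_pred H chi.
Proof.
apply/asboolP; split=> [h x Hh|].
  have [Hgh <-] := g_norm Hh; rewrite -ind_valM //.
  by congr (ind_val f _); rewrite -[RHS]mulgA mulKg mulgA.
have [_ [s sP]] := ind_valP f; exists [seq (g^-1 * y)%g | y <- s].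
move=> x /= /sP [y /= ys [h Hh hy]].
exists (g^-1 * y)%g; first exact: map_f.
exists (g^-1 * h * g)%g; first exact: gV_norm.
by rewrite mulgA mulgK -mulgA hy mulKg.
Qed.

Definition ind_ltrans (f : ind_space H chi) : ind_space H chi :=
  IndSpace (ind_ltrans_in_ind f).

End LeftTranslation.
End Induced.

Section Maximal.
Local Open Scope ring_scope.
Variables (C : numClosedFieldType) (G : groupType) (H : set G) (chi : G -> C).
Hypothesis Hgrp : is_subgroup H.
Hypothesis chi_char : is_character H chi.
Hypothesis ind_irr : irreducible (ind_rep H chi).

(** In infinite dimension an endomorphism need not have an eigenvector, but left
translation [T] by [g] is explicit enough for two cases to suffice.  If some
positive power of [g] lies in [H], then [T] has an eigenvector, hence is a
scalar, which moves the support of no function and puts [g] in [H].  Otherwise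
[T - 1] would be onto, and solving [T f - f = f0] with [f0] supported on [H]
forces [f] to be a non-zero constant on all positive or on all non-positive
powers of [g]; these lie in distinct cosets. *)
Lemma irr_stabilizer (g : G) :
  (forall h, H h -> H (g * h / g)%g /\ chi (g * h / g)%g = chi h) ->
  (forall h, H h -> H (g^-1 * h * g)%g) ->
  H g.
Proof.
move=> g_norm gV_norm.
pose T := ind_ltrans g_norm gV_norm.
pose f0 := ind_coset Hgrp chi_char 1%g.
have TE f x : T f x = f (g * x)%g by [].
have ind_linE (a : C) (f f' : ind_space H chi) x :
  (a *: f + f') x = a * f x + f' x by [].
have f0_1 : f0 1%g = 1 by exact: ind_coset_id.
have f0_out x : ~ H x -> f0 x = 0.
  by move=> nHx; apply: ind_coset_out; rewrite invg1 mulg1.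
clearbody f0; apply: contrapT => nHg.
have [[k0 [k0_gt0 Hk0]]|no_pow] := pselect (exists k, (0 < k)%N /\ H (g ^+ k)%g).
- have ex_k : exists k, (0 < k)%N && `[< H (g ^+ k)%g >].
    by exists k0; rewrite k0_gt0; apply/asboolP.
  have [[//|k] /asboolP Hk k_min] := ex_minnP ex_k.
  pose l := k.+1.-root (chi (g ^+ k.+1)%g).
  have lk : l ^+ k.+1 = chi (g ^+ k.+1)%g by exact: rootCK.
  have l_neq0 : l != 0.
    by apply: contraTneq (chi_char.1 _ Hk) => l0; rewrite -lk l0 expr0n eqxx.
  pose W : set (ind_space H chi) := [set f | forall x, f (g * x)%g = l * f x]%classic.
  have [||W0|WT] := ind_irr.2 W.
  + split=> [x|a f f' Wf Wf' x]; first by rewrite /= mulr0.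
    by rewrite !ind_linE Wf Wf' mulrDr mulrCA.
  + by move=> x f Wf y /=; rewrite -mulgA Wf.
  (* As [T ^ k.+1] multiplies by [l ^ k.+1], weighting the orbit of [f0] gives
     an eigenvector for [l]; the minimality of [k.+1] keeps its value at [1] equal
     to that of [f0]. *)
  + pose F := \sum_(j < k.+1) (l ^- j) *: iter j T f0.
    have iterE j x : iter j T f0 x = f0 (g ^+ j * x)%g.
      elim: j x => [|j IHj] x; first by rewrite expg0 mul1g.
      by rewrite iterS TE IHj mulgA -expgSr.
    have FE x : F x = \sum_(j < k.+1) l ^- j * f0 (g ^+ j * x)%g.
      by rewrite ind_sumE; apply: eq_bigr => j _; rewrite -iterE.
    have F1 : F 1%g = 1.
      rewrite FE big_ord_recl expr0 invr1 mul1r expg0 mul1g f0_1.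
      rewrite big1 ?addr0 // => j _; rewrite mulg1 f0_out ?mulr0 // => Hj.
      have := k_min (lift ord0 j); rewrite lift0 /= asboolT // => /(_ isT).
      by move/leq_trans/(_ (ltn_ord j)); rewrite ltnn.
    have : W F.
      move=> x; rewrite !FE mulr_sumr.
      rewrite big_ord_recr big_ord_recl /= addrC; congr (_ + _).
        rewrite expr0 invr1 mul1r expg0 mul1g mulgA -expgSr.
        rewrite (ind_valM _ _ Hk) -lk mulrA; congr (_ * _).
        by rewrite exprS mulrCA mulVf ?mulr1 ?expf_neq0.
      apply: eq_bigr => j _; rewrite mulgA -expgSr mulrA; congr (_ * _).
      by rewrite exprS invfM mulVKf.
    rewrite W0 => /= F0; move/eqP: F1; rewrite F0 eq_sym; exact/negP/oner_neq0.
  + have : W f0 by rewrite WT.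
    move/(_ 1%g); rewrite mulg1 f0_1 f0_out // mulr1 => /esym/eqP.
    exact/negP.
- pose W : set (ind_space H chi) := [set f |
    exists f' : ind_space H chi, forall x, f x = f' (g * x)%g - f' x]%classic.
  have [||W0|WT] := ind_irr.2 W.
  + split=> [|a f f' [e fE] [e' fE']]; first by exists 0 => x; rewrite subr0.
    by exists (a *: e + e') => x; rewrite !ind_linE fE fE' mulrBr addrACA opprD.
  + move=> x f [e fE]; exists (ind_act x e) => y /=.
    by rewrite fE mulgA.
  + have : W (T f0 - f0) by exists f0.
    rewrite W0 => /= /(congr1 (fun f : ind_space H chi => f 1%g)).
    change (f0 (g * 1)%g - f0 1%g = 0 -> False); rewrite mulg1 f0_out // f0_1 sub0r.
    by move/eqP; rewrite oppr_eq0 oner_eq0.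
  (* [f] jumps by [1] between [1] and [g] and is constant on either side. *)
  + have [f fE] : W f0 by rewrite WT.
    have no_powV k : (0 < k)%N -> ~ H (g ^- k)%g.
      by move=> k_gt0 Hk; apply: no_pow; exists k; split=> //; apply: subgVr.
    have fS : f g = f 1%g + 1.
      by have := fE 1%g; rewrite f0_1 mulg1 => ->; rewrite addrC subrK.
    have fpos k : f (g ^+ k.+1)%g = f g.
      elim: k => [|k <-]; first by rewrite expg1.
      apply/eqP; rewrite -subr_eq0 [X in f X]expgS -fE f0_out // => Hk.
      by apply: no_pow; exists k.+1.
    have fneg k : f (g ^- k)%g = f 1%g.
      elim: k => [|k <-]; first by rewrite expg0 invg1.
      apply/eqP; rewrite eq_sym -subr_eq0.
      have {1}-> : (g ^- k = g * g ^- k.+1)%g by rewrite expgSr invgM mulVKg.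
      by rewrite -fE f0_out //; apply: no_powV.
    have [f1_0|f1_n0] := eqVneq (f 1%g) 0.
      have [i [j [ij Hij]]] : exists i j, (i < j)%N /\ H (g ^+ j.+1 / g ^+ i.+1)%g.
        apply: (ind_finite_support Hgrp (f := f) (t := fun i => g ^+ i.+1)%g) => i.
        by rewrite fpos fS f1_0 add0r oner_neq0.
      apply: no_pow; exists (j - i)%N; rewrite subn_gt0; split=> //.
      by rewrite -subSS expgnFr // ltnS ltnW.
    have [i [j [ij Hij]]] : exists i j, (i < j)%N /\ H (g ^- j / g ^- i)%g.
      apply: (ind_finite_support Hgrp (f := f) (t := fun i => g ^- i)%g) => i.
      by rewrite fneg.
    apply: (@no_powV (j - i)%N); rewrite ?subn_gt0 //.
    move: Hij; rewrite invgK => Hij.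
    have -> : (g ^- (j - i) = g ^- j * g ^+ i)%g; last by [].
    apply: (mulIg (g ^+ (j - i))%g).
    by rewrite mulVg -mulgA -expgnDr subnKC ?mulVg // ltnW.
Qed.
End Maximal.

(** * Finite abelian groups with a pairing *)

(* Records the join of the additive and the finite structures, which both exist
   on this type. *)
HB.instance Definition _ (I : finType) (M : finZmodType) :=
  GRing.Zmodule.on {ffun I -> M}.

Section FinitePairing.
Local Open Scope ring_scope.

(** Lagrange's theorem, in the form of an enumerated transversal that can be
lifted to an infinite group. *)
Lemma zmod_transversal (A : finZmodType) (S : {set A}) :
  0 \in S -> {in S &, forall a b, a - b \in S} ->
  exists (d : nat) (t : 'I_d -> A),
    [/\ forall i j, t i - t j \in S -> i = j,
        forall a, exists i, a - t i \in S
      & (d * #|S| = #|A|)%N].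
Proof.
move=> S0 SB.
have SN a : a \in S -> - a \in S by move=> Sa; rewrite -sub0r SB.
have SD a b : a \in S -> b \in S -> a + b \in S.
  by move=> Sa Sb; rewrite -[b]opprK SB ?SN.
(* [r] picks a representative depending only on the coset of [a]. *)
pose r a := odflt a [pick b | a - b \in S].
have rP a : a - r a \in S.
  by rewrite /r; case: pickP => [//|/(_ a)]; rewrite subrr S0.
have r_eq a b : a - b \in S -> r a = r b.
  move=> Sab; rewrite /r (@eq_pick _ _ (fun c => b - c \in S)).
    by case: pickP => [//|/(_ b)]; rewrite subrr S0.
  move=> c /=; apply/idP/idP => Sc.
    by rewrite -(subrKA a) SD // -opprB SN.
  by rewrite -(subrKA b) SD.
pose T := [set r a | a in A].
have rT b : b \in T -> r b = b.
  by case/imsetP => a _ ->; apply/esym/r_eq/rP.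
exists #|T|, enum_val; split=> [i j Sij|a|].
- by apply: enum_val_inj; rewrite -[LHS]rT ?enum_valP // (r_eq _ _ Sij) rT ?enum_valP.
- have Tra : r a \in T by exact: imset_f.
  by exists (enum_rank_in Tra (r a)); rewrite enum_rankK_in.
rewrite -[RHS]sum1_card (partition_big_imset r) /= -sum_nat_const.
apply: eq_bigr => b Tb; rewrite sum1_card -[LHS](card_imset _ (addrI b)).
apply: eq_card => a; apply/imsetP/idP => [[c Sc ->]|].
  rewrite unfold_in /=; apply/eqP; rewrite -[RHS](rT b Tb); apply: r_eq.
  by rewrite addrC addKr.
rewrite unfold_in /= => /eqP <-; exists (a - r a) => //.
by rewrite addrC subrK.
Qed.

(** Orthogonality of characters: translating the summation index by [a]
multiplies the sum by [phi a]. *)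
Lemma sum_character (C : idomainType) (A : finZmodType) (S : {set A})
    (phi : A -> C) :
  0 \in S -> {in S &, forall a b, a - b \in S} ->
  {in S &, forall a b, phi (a + b) = phi a * phi b} ->
  \sum_(a in S) phi a = if [forall a in S, phi a == 1] then #|S|%:R else 0.
Proof.
move=> S0 SB phiM.
have SN a : a \in S -> - a \in S by move=> Sa; rewrite -sub0r SB.
have SD a b : a \in S -> b \in S -> a + b \in S.
  by move=> Sa Sb; rewrite -[b]opprK SB ?SN.
case: ifPn => [/forall_inP phi1|].
  by rewrite -sumr_const; apply: eq_bigr => a /phi1/eqP.
rewrite negb_forall_in => /exists_inP [a Sa phia].
have : phi a * \sum_(b in S) phi b = \sum_(b in S) phi b.
  rewrite mulr_sumr [RHS](reindex_inj (addrI a)) /=.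
  apply: eq_big => [b|b Sb]; last by rewrite phiM.
  by apply/idP/idP => [/(SD _ _ Sa)//|Sab]; rewrite -[b](addKr a) addrC SB.
move/eqP; rewrite -subr_eq0 -{2}[\sum_(_ in _) _]mul1r -mulrBl mulf_eq0.
by rewrite subr_eq0 (negbTE phia) => /eqP.
Qed.

(** [B] is an antisymmetric bimultiplicative pairing on [A] and [S] is equal
to its own orthogonal; the last set is the radical of [B].  The double sum of
[B a b] over [a] in [A] and [b] in [S] is [|S|^2] when summed over [b] first,
since only [a] in the orthogonal of [S] contributes, and [|A| |Rad|] when
summed over [a] first, since only [b] in the radical contributes. *)
Lemma lagrangian_transversal (C : numFieldType) (A : finZmodType) (S : {set A})
    (B : A -> A -> C) :
  (forall a b, B a b != 0) ->
  (forall a a' b, B (a + a') b = B a b * B a' b) ->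
  (forall a b, B b a = (B a b)^-1) ->
  (forall a, (a \in S) = [forall b in S, B a b == 1]) ->
  exists (d : nat) (t : 'I_d -> A),
    [/\ forall i j, t i - t j \in S -> i = j,
        forall a, exists i, a - t i \in S
      & (d ^ 2 * #|[set b | [forall a, B a b == 1%R]]| = #|A|)%N].
Proof.
move=> B_neq0 BMl BV SP; set Rad := [set b | _].
have BMr a b b' : B a (b + b') = B a b * B a b' by rewrite ![B a _]BV BMl invfM.
have B0 b : B 0 b = 1.
  by apply: (mulfI (B_neq0 0 b)); rewrite -BMl addr0 mulr1.
have BN a b : B (- a) b = (B a b)^-1.
  by apply: (mulfI (B_neq0 a b)); rewrite -BMl subrr B0 mulfV.
have S1 a b : a \in S -> b \in S -> B a b = 1.
  by rewrite SP => /forall_inP Sa /Sa/eqP.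
have S0 : 0 \in S by rewrite SP; apply/forall_inP => b _; rewrite B0.
have SB : {in S &, forall a b, a - b \in S}.
  move=> a b Sa Sb; rewrite SP; apply/forall_inP => c Sc.
  by rewrite BMl BN !S1 // invr1 mulr1.
have RadS : Rad \subset S.
  apply/fintype.subsetP => b; rewrite inE => /fintype.forallP b1; rewrite SP.
  by apply/forall_inP => c _; rewrite BV (eqP (b1 c)) invr1.
have sumBr a : \sum_(b in S) B a b = if [forall b in S, B a b == 1] then #|S|%:R else 0.
  by apply: sum_character => // b c _ _; apply: BMr.
have sumBl b : \sum_(a in [set: A]) B a b =
    if [forall a in [set: A], B a b == 1] then #|[set: A]|%:R else 0.
  by apply: sum_character => [|a c _ _|a c _ _]; rewrite ?inE.
have cardS : (#|S| * #|S| = #|A| * #|Rad|)%N.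
  apply/eqP; rewrite -(eqr_nat C) !natrM; apply/eqP.
  transitivity (\sum_(a in [set: A]) \sum_(b in S) B a b).
    rewrite (bigID (mem S)) /= [X in _ + X]big1 ?addr0; last first.
      move=> a /andP[_ aS]; rewrite sumBr.
      by rewrite -SP (negbTE aS).
    under eq_bigl => a do rewrite inE andTb.
    rewrite (eq_bigr (fun=> #|S|%:R)) ?sumr_const ?mulr_natr // => a aS.
    by rewrite sumBr -SP aS.
  rewrite exchange_big /= (bigID (mem Rad)) /= [X in _ + X]big1 ?addr0; last first.
    move=> b /andP[_ bRad]; rewrite sumBl.
    case: ifP => // /forall_inP b1; case/negP: bRad; rewrite inE.
    by apply/fintype.forallP => a; apply: b1; rewrite inE.
  rewrite (eq_bigl (mem Rad)); last first.
    by move=> b; apply/andb_idl => /(fintype.subsetP RadS).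
  rewrite (eq_bigr (fun=> #|A|%:R)) ?sumr_const ?mulr_natr // => b bRad.
  rewrite sumBl.
  rewrite ifT ?cardsT //; apply/forall_inP => a _.
  by have : b \in Rad by []; rewrite inE => /fintype.forallP/(_ a).
have [d [t [t_inj t_sur dS]]] := zmod_transversal S0 SB.
exists d, t; split=> //; apply/eqP.
have A_gt0 : (0 < #|A|)%N by apply/card_gt0P; exists 0.
by rewrite -(eqn_pmul2l A_gt0) mulnCA -cardS -dS; apply/eqP; ring.
Qed.

Lemma card_multiples (M k : nat) :
  (0 < k)%N -> (k %| M.+1)%N -> #|[pred x : 'I_M.+1 | k %| x]%N| = (M.+1 %/ k)%N.
Proof.
move=> k_gt0 kM; rewrite -[RHS]card_ord.
have lt_ik (i : 'I_(M.+1 %/ k)) : (i * k < M.+1)%N by rewrite -ltn_divRL.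
rewrite -(card_codom (f := fun i => Ordinal (lt_ik i))) => [|i j [/eqP]].
  apply: eq_card => x; rewrite inE; apply/idP/codomP => [kx|[i ->]] /=; last first.
    by rewrite dvdn_mull.
  have lt_x : (x %/ k < M.+1 %/ k)%N by rewrite ltn_divRL // divnK.
  by exists (Ordinal lt_x); apply/val_inj; rewrite /= divnK.
by rewrite eqn_pmul2r // => /eqP/val_inj.
Qed.

Lemma dvdn_div_gcd (m t x : nat) :
  (0 < m)%N -> (m %| x * t)%N = (m %/ gcdn m t %| x)%N.
Proof.
move=> m_gt0; have g_gt0 : (0 < gcdn m t)%N by rewrite gcdn_gt0 m_gt0.
have -> : (x * t = x * (t %/ gcdn m t) * gcdn m t)%N by rewrite -mulnA divnK ?dvdn_gcdr.
rewrite -[X in (X %| _)%N = _](divnK (dvdn_gcdl m t)).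
rewrite dvdn_pmul2r // Gauss_dvdl // /coprime -(eqn_pmul2r g_gt0).
by rewrite muln_gcdl !divnK ?dvdn_gcdl ?dvdn_gcdr // mul1n.
Qed.

Lemma card_dvdn_mul (M t : nat) :
  #|[pred x : 'I_M.+1 | M.+1 %| x * t]%N| = gcdn M.+1 t.
Proof.
have E : [pred x : 'I_M.+1 | M.+1 %| x * t]%N =i
         [pred x : 'I_M.+1 | M.+1 %/ gcdn M.+1 t %| x]%N.
  by move=> x; rewrite !inE dvdn_div_gcd.
have g_gt0 : (0 < gcdn M.+1 t)%N by rewrite gcdn_gt0.
rewrite (eq_card E) => {E}; move: (gcdn M.+1 t) g_gt0 (dvdn_gcdl M.+1 t).
move=> g g_gt0 /dvdnP [q NE]; have q_gt0 : (0 < q)%N by case: q NE.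
have -> : (M.+1 %/ g = q)%N by rewrite NE mulnK.
by rewrite card_multiples // NE ?mulKn // dvdn_mulr.
Qed.

End FinitePairing.

(** * Heisenberg groups *)

Section HeisenbergGroup.
Local Open Scope ring_scope.
Variables (n : nat) (s : 'I_n -> nat).
Implicit Types g h x y : heisenberg s.

(** The centre can be larger when some [s j] vanishes; this is the part of it
that is always there. *)
Definition heis_center (c : int) : heisenberg s := Heisenberg 0 0 c.

(** The commutator of [g] and [h] is central; this is its coordinate. *)
Definition heis_comm g h : int :=
  heis_form s (hu g) (hv h) - heis_form s (hu h) (hv g).

Lemma heis_ext g h : hu g = hu h -> hv g = hv h -> hz g = hz h -> g = h.
Proof. by case: g; case: h => /= ? ? ? ? ? ? -> -> ->. Qed.

Lemma heis_centerD b c : heis_center (b + c) = (heis_center b * heis_center c)%g.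
Proof. by apply: heis_ext; rewrite /= ?heis_form0l ?addr0. Qed.

Lemma heis_center0 : heis_center 0 = 1%g.
Proof. by []. Qed.

Lemma heis_centerC g c : (g * heis_center c)%g = (heis_center c * g)%g.
Proof.
by apply: heis_ext; rewrite /= ?heis_form0l ?heis_form0r ?addr0 ?add0r // addrC.
Qed.

Lemma heis_conj g h : (g * h / g)%g = (h * heis_center (heis_comm g h))%g.
Proof.
apply: heis_ext => /=; rewrite ?addr0 1?addrC ?addKr //.
by rewrite heis_form0r !heis_formNr heis_formDl /heis_comm; ring.
Qed.

Lemma heis_conjV g h : (g^-1 * h * g)%g = (h * heis_center (- heis_comm g h))%g.
Proof.
rewrite -{2}[g]invgK heis_conj; congr (_ * heis_center _)%g.
by rewrite /heis_comm /= heis_formNl heis_formNr; ring.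
Qed.

Lemma heis_commMl g g' h :
  heis_comm (g * g')%g h = heis_comm g h + heis_comm g' h.
Proof. by rewrite /heis_comm /= heis_formDl heis_formDr; ring. Qed.

Lemma heis_commC g h : heis_comm h g = - heis_comm g h.
Proof. by rewrite /heis_comm opprB. Qed.

Lemma heis_comm_center c h : heis_comm (heis_center c) h = 0.
Proof. by rewrite /heis_comm /= heis_form0l heis_form0r subrr. Qed.

Lemma heis_commg x y : [~ x, y]%g = heis_center (heis_comm x y).
Proof.
rewrite /commg /conjg; apply: (mulgI x); rewrite mulVKg; apply: (mulgI y).
rewrite mulVKg -[LHS](mulgVK x) heis_conj -mulgA -heis_centerC; by [].
Qed.
End HeisenbergGroup.

Section Commutators.
Local Open Scope ring_scope.
Variables (n : nat) (s : 'I_n.+1 -> nat).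
Hypothesis s_dvd : forall j, (s ord0 %| s j)%N.
Local Notation t j := (s j %/ s ord0)%N.

Lemma heis_commE (g h : heisenberg s) :
  heis_comm g h = (s ord0)%:Z *
    \sum_j (t j)%:Z * (hu g 0 j * hv h 0 j - hu h 0 j * hv g 0 j).
Proof.
rewrite /heis_comm /heis_form -sumrB mulr_sumr; apply: eq_bigr => j _.
by rewrite -{1 2}(divnK (s_dvd j)) PoszM; ring.
Qed.

(** Every value of the commutator form is a multiple of [s ord0], because
[s ord0] divides all [s j], and every multiple is the value at a pair of elements
supported on the first coordinate. *)
Lemma heis_commutator_subgroup x :
  commutator_subgroup (heisenberg s) x <->
  exists m : int, x = heis_center s ((s ord0)%:Z * m).
Proof.
split=> [|[m ->]].
  move/(_ [set x | exists m : int, x = heis_center s ((s ord0)%:Z * m)]%classic); apply.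
  split; last first.
    by move=> _ [g [h ->]]; rewrite heis_commg heis_commE; eexists.
  split=> [|_ _ [a ->] [b ->]]; first by exists 0; rewrite mulr0.
  exists (a - b); apply: (mulIg (heis_center s ((s ord0)%:Z * b))).
  by rewrite mulgVK -heis_centerD; congr heis_center; ring.
move=> K [Kgrp Kcomm]; apply: Kcomm.
exists (Heisenberg (delta_mx 0 ord0) 0 0), (Heisenberg 0 (const_mx m) 0).
rewrite heis_commg; congr heis_center; rewrite /heis_comm /= heis_form0r subr0.
rewrite /heis_form (bigD1 ord0) //= big1 ?addr0 => [|j j0];
  rewrite !mxE ?eqxx ?mulr1 //.
by rewrite (negbTE j0) mulr0 mul0r.
Qed.
End Commutators.

(** * The inducing pair of an irreducible monomial representation *)

Section Monomial.
Local Open Scope ring_scope.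
Variables (C : numClosedFieldType) (n : nat) (s : 'I_n.+1 -> nat).
Hypothesis s_dvd : forall j, (s ord0 %| s j)%N.
Variables (H : set (heisenberg s)) (chi : heisenberg s -> C).
Hypothesis Hgrp : is_subgroup H.
Hypothesis chi_char : is_character H chi.
Hypothesis ind_irr : irreducible (ind_rep H chi).
Local Notation t j := (s j %/ s ord0)%N.
Local Notation zc := (heis_center s).
Local Notation psi c := (chi (zc c)).

Lemma subg_center c : H (zc c).
Proof.
apply: (irr_stabilizer Hgrp chi_char ind_irr) => h Hh.
  by rewrite heis_conj heis_comm_center heis_center0 mulg1.
by rewrite heis_conjV heis_comm_center oppr0 heis_center0 mulg1.
Qed.

Lemma central_charD b c : psi (b + c) = psi b * psi c.
Proof. by rewrite heis_centerD chi_char.2 //; apply: subg_center. Qed.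

Lemma central_char0 : psi 0 = 1.
Proof. exact: (chi1 Hgrp chi_char). Qed.

Lemma central_char_neq0 c : psi c != 0.
Proof. exact: chi_char.1 (subg_center c). Qed.

Lemma central_charN c : psi (- c) = (psi c)^-1.
Proof.
apply: (mulfI (central_char_neq0 c)).
by rewrite -central_charD subrr central_char0 mulfV ?central_char_neq0.
Qed.

Lemma central_charMn c k : psi (c * k%:Z) = psi c ^+ k.
Proof.
elim: k => [|k IHk]; first by rewrite mulr0 central_char0.
by rewrite intS mulrDr mulr1 central_charD IHk exprS.
Qed.

(** [H] is a maximal isotropic subgroup.  It is isotropic because [chi] is a
character, hence trivial on commutators of elements of [H]; and an element
orthogonal to [H] stabilizes [(H, chi)], since conjugating [h] by [g] multiplies
it by the central element [heis_comm g h]. *)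
Lemma subgroup_perp g : H g <-> forall h, H h -> psi (heis_comm g h) = 1.
Proof.
split=> [Hg h Hh|g_perp].
  apply: (mulfI (chi_char.1 h Hh)); rewrite mulr1 -chi_char.2 //;
    last exact: subg_center.
  have Hgh : H (g * h)%g by exact: subgM.
  have HgV : H (g^-1)%g by exact: subgV.
  rewrite -heis_conj chi_char.2 // chi_char.2 // mulrAC -chi_char.2 // mulgV.
  by rewrite (chi1 Hgrp chi_char) mul1r.
apply: (irr_stabilizer Hgrp chi_char ind_irr) => h Hh; have Hc := subg_center.
  by rewrite heis_conj chi_char.2 // g_perp // mulr1; split=> //; apply: subgM.
by rewrite heis_conjV; apply: subgM.
Qed.

Lemma restriction_orderE m :
  restriction_has_order (commutator_subgroup (heisenberg s)) chi m <->
  is_least_pos (fun k : nat => psi (s ord0)%:Z ^+ k = 1) m.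
Proof.
have E k : (forall x, commutator_subgroup (heisenberg s) x -> chi x ^+ k = 1) <->
    psi (s ord0)%:Z ^+ k = 1.
  split=> [K1|psi1 x /(heis_commutator_subgroup s_dvd) [m' ->]].
    by apply/K1/(heis_commutator_subgroup s_dvd); exists 1; rewrite mulr1.
  case: m' => m'; rewrite ?NegzE ?mulrN ?central_charN central_charMn.
    by rewrite -exprM mulnC exprM psi1 expr1n.
  by rewrite exprVn -exprM mulnC exprM psi1 expr1n invr1.
by split=> -[m_gt0 /E Pm m_min]; split=> // k k_gt0 /E; apply: m_min.
Qed.

Section FiniteOrderChar.
Variable M : nat.
Local Notation N := M.+1.
Hypothesis psi_order : is_least_pos (fun k : nat => psi (s ord0)%:Z ^+ k = 1) N.

Lemma central_char_eq1 (m : int) : (psi ((s ord0)%:Z * m) == 1) = (N%:Z %| m)%Z.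
Proof.
have prim : N.-primitive_root (psi (s ord0)%:Z).
  have [_ psiN1 psi_min] := psi_order.
  apply/andP; split=> //; apply/fintype.forallP => i; rewrite unity_rootE.
  apply/eqP; case: (eqVneq i.+1 N) => [->|iN]; first by rewrite psiN1 eqxx.
  apply/negbTE/negP => /eqP psi1; have := psi_min i.+1 isT psi1.
  by rewrite leqNgt ltn_neqAle iN ltn_ord.
rewrite dvdzE; case: m => m; rewrite ?NegzE ?mulrN ?central_charN central_charMn;
  by rewrite ?invr_eq1 ?abszN absz_nat -(prim_order_dvd prim).
Qed.

Local Notation A := {ffun bool * 'I_n.+1 -> 'I_N}.

(** Reduction modulo [N] of the non-central coordinates, the boolean telling
[u] from [v].  Integer multiples of the generator [inZp 1] are used because they
are additive for every [N], including [N = 1]. *)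
Definition heis_red (g : heisenberg s) : A :=
  [ffun p => inZp 1 *~ (if p.1 then hu g 0 p.2 else hv g 0 p.2)].

Definition heis_lift (a : A) : heisenberg s :=
  Heisenberg (\row_j (a (true, j) : nat)%:Z) (\row_j (a (false, j) : nat)%:Z) 0.

Lemma heis_liftK : cancel heis_lift heis_red.
Proof.
move=> a; apply/ffunP => -[b j]; rewrite ffunE /=.
by case: b; rewrite mxE -pmulrn Zp_mulrn; apply/val_inj;
  rewrite /= modnMml mul1n modn_small.
Qed.

Lemma heis_redM g h : heis_red (g * h)%g = heis_red g + heis_red h.
Proof. by apply/ffunP => -[[] j]; rewrite !ffunE /= mxE mulrzDr. Qed.

Lemma heis_redV g : heis_red (g^-1)%g = - heis_red g.
Proof. by apply/ffunP => -[[] j]; rewrite !ffunE /= mxE mulrNz. Qed.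

Lemma Zp_mulrz_eq0 (m : int) : ((inZp 1 : 'I_N) *~ m == 0) = (N%:Z %| m)%Z.
Proof.
have E (k : nat) : ((inZp 1 : 'I_N) *+ k == 0) = (N %| k)%N.
  by rewrite Zp_mulrn -val_eqE /= modnMml mul1n.
by rewrite dvdzE; case: m => m;
  rewrite ?NegzE ?mulrNz ?oppr_eq0 ?abszN absz_nat -pmulrn E.
Qed.

Lemma heis_red_eq0 g :
  heis_red g = 0 -> forall j, (N%:Z %| hu g 0%R j)%Z /\ (N%:Z %| hv g 0%R j)%Z.
Proof.
move=> /ffunP g0 j; have := g0 (true, j); have := g0 (false, j).
by rewrite !ffunE /= => /eqP + /eqP; rewrite !Zp_mulrz_eq0.
Qed.

Lemma central_char_comm_red0 g h : heis_red g = 0 -> psi (heis_comm g h) = 1.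
Proof.
move=> /heis_red_eq0 g0; apply/eqP; rewrite heis_commE // central_char_eq1.
apply: rpred_sum => j _; have [gu gv] := g0 j.
apply: dvdz_mull; apply: rpredB; first exact: dvdz_mulr.
exact: dvdz_mull.
Qed.

(** Elements vanishing modulo [N] are orthogonal to everything, so that the
pairing depends only on reductions modulo [N]. *)
Lemma central_char_comm_red g g' h :
  heis_red g = heis_red g' -> psi (heis_comm g h) = psi (heis_comm g' h).
Proof.
move=> gg'; rewrite -[g](mulgVK g') heis_commMl central_charD.
by rewrite central_char_comm_red0 ?mul1r // heis_redM heis_redV gg' subrr.
Qed.

Lemma subg_red g g' : heis_red g = heis_red g' -> H g -> H g'.
Proof.
move=> gg' /subgroup_perp Hg; apply/subgroup_perp => h Hh.
by rewrite -(central_char_comm_red _ gg') Hg.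
Qed.

(** The coordinate [b (e, j)] is tested by pairing with the [j]-th basis vector
of the opposite half. *)
Lemma heis_pairing_radical (b : A) :
  [forall a : A, psi (heis_comm (heis_lift a) (heis_lift b)) == 1] =
  (b \in family (fun p : bool * 'I_n.+1 =>
                   [pred x : 'I_N | N %| x * t p.2]%N)).
Proof.
have lift_comm a : heis_comm (heis_lift a) (heis_lift b) = (s ord0)%:Z *
    \sum_j ((b (false, j) * t j)%N%:Z * (a (true, j))%:Z
            - (b (true, j) * t j)%N%:Z * (a (false, j))%:Z).
  rewrite heis_commE //; congr (_ * _); apply: eq_bigr => j _.
  by rewrite !mxE !PoszM; ring.
apply/fintype.forallP/familyP => [b1 [e j]|bR a]; last first.
  rewrite lift_comm central_char_eq1; apply: rpred_sum => j _.
  by rewrite rpredB // dvdz_mulr //; [apply: (bR (false, j)) | apply: (bR (true, j))].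
rewrite inE /=.
pose g : heisenberg s := Heisenberg (if e then 0 else delta_mx 0 j)
                      (if e then delta_mx 0 j else 0) 0.
have := b1 (heis_red g).
rewrite (central_char_comm_red (g' := g)) ?heis_liftK // heis_commE // central_char_eq1.
rewrite (bigD1 j) //= big1 ?addr0.
  by case: (e); rewrite !mxE !eqxx /= ?mul0r ?mulr0 ?mulr1 ?mul1r ?sub0r ?subr0
     ?mulrN dvdzE ?abszN /= mulnC.
by move=> i ij; case: (e); rewrite !mxE (negbTE ij) ?andbF ?mulr0 ?mul0r ?subrr ?mulr0.
Qed.

(** [heis_red] identifies the cosets of [H] with those of its image [S], as [H]
contains the kernel of the reduction; [S] inherits from [subgroup_perp] the
property of being its own orthogonal, and the index follows from
[lagrangian_transversal] by counting the radical. *)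
Lemma heis_ind_dim :
  has_dimension (ind_space H chi) (\prod_j (N %/ gcdn N (t j)))%N.
Proof.
pose P a b := psi (heis_comm (heis_lift a) (heis_lift b)).
pose S := [set a : A | `[< H (heis_lift a) >]]%SET.
have [||||d [u [u_inj u_sur d2]]] := @lagrangian_transversal C A S P.
- by move=> a b; apply: central_char_neq0.
- move=> a a' b; rewrite -central_charD -heis_commMl; apply: central_char_comm_red.
  by rewrite heis_redM !heis_liftK.
- by move=> a b; rewrite -central_charN -heis_commC.
- move=> a; rewrite inE; apply/asboolP/forall_inP => [Ha b|aS].
    by rewrite inE => /asboolP Hb; apply/eqP; move/subgroup_perp: Ha; apply.
  apply/subgroup_perp => h Hh.
  have /aS/eqP <- : heis_red h \in S.
    by rewrite inE; apply/asboolP; apply: subg_red Hh; rewrite heis_liftK.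
  rewrite /P heis_commC central_charN.
  rewrite (central_char_comm_red _ (esym (heis_liftK (heis_red h)))).
  by rewrite -central_charN -heis_commC.
have -> : (\prod_j (N %/ gcdn N (t j)))%N = d.
  apply/eqP; rewrite -(eqn_exp2r _ _ (isT : 0 < 2)%N); apply/eqP.
  pose F (p : bool * 'I_n.+1) := [pred x : 'I_N | N %| x * t p.2]%N.
  have R_gt0 : (0 < \prod_p #|F p|)%N.
    by rewrite prodn_gt0 // => p; apply/card_gt0P; exists ord0; rewrite inE.
  apply/eqP; rewrite -(eqn_pmul2r R_gt0); apply/eqP.
  rewrite (eq_card (B := family F)) in d2; last first.
    by move=> b; rewrite inE; apply: heis_pairing_radical.
  rewrite card_family foldrE big_map big_enum /= in d2.
  rewrite d2 card_ffun card_ord -prod_nat_const.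
  have -> : ((\prod_j (N %/ gcdn N (t j))) ^ 2 =
      \prod_(p : bool * 'I_n.+1) (N %/ gcdn N (t p.2)))%N.
    by rewrite -(pair_bigA _ (fun _ j => N %/ gcdn N (t j))%N) big_bool.
  rewrite -big_split; apply: eq_bigr => p _ /=.
  by rewrite card_dvdn_mul divnK ?dvdn_gcdl.
apply: (ind_dim Hgrp chi_char (t := heis_lift \o u)).
  move=> i j Hij; apply: u_inj; rewrite inE; apply/asboolP.
  by apply: subg_red Hij; rewrite heis_redM heis_redV !heis_liftK.
move=> g; have [k] := u_sur (heis_red g); rewrite inE => /asboolP Hk.
exists k; apply: subg_red Hk => /=.
by rewrite heis_redM heis_redV !heis_liftK.
Qed.

End FiniteOrderChar.
End Monomial.

Section FiniteOrder.
Local Open Scope ring_scope.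

(** Otherwise the powers of [g] lie in distinct cosets and the functions
supported on these are linearly independent. *)
Lemma ind_finite_dim_power (C : fieldType) (G : groupType) (H : set G)
    (chi : G -> C) (d : nat) (g : G) :
  is_subgroup H -> is_character H chi -> has_dimension (ind_space H chi) d ->
  exists k, (0 < k)%N /\ H (g ^+ k)%g.
Proof.
move=> Hgrp chi_char Hd; apply: contrapT => no_pow.
suff : (d.+1 <= d)%N by rewrite ltnn.
pose w (i : 'I_d.+1) := ind_coset Hgrp chi_char (g ^+ i)%g.
apply: (has_dimension_free (w := w) Hd).
apply: ind_coset_free.
have no_lt (k l : nat) : (k < l)%N -> ~ H (g ^+ l / g ^+ k)%g.
  move=> kl Hkl; apply: no_pow; exists (l - k)%N; rewrite subn_gt0; split=> //.
  by rewrite expgnFr // ltnW.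
move=> k l Hkl; apply: val_inj; case: (ltngtP k l) => // kl; exfalso.
  by apply: (no_lt _ _ kl); apply: subg_div_sym.
exact: (no_lt _ _ kl).
Qed.

Lemma heis_commX n (s : 'I_n -> nat) (g h : heisenberg s) k l :
  heis_comm (g ^+ k)%g (h ^+ l)%g = heis_comm g h * (k * l)%N%:Z.
Proof.
have Xl k' g' h' : heis_comm (s := s) (g' ^+ k')%g h' = heis_comm g' h' * k'%:Z.
  elim: k' => [|k' IHk]; first by rewrite expg0 -heis_center0 heis_comm_center mulr0.
  by rewrite expgS heis_commMl IHk intS; ring.
by rewrite Xl heis_commC Xl heis_commC PoszM; ring.
Qed.

(** The central element in question is a commutator of two elements [x] and [y],
some powers [x ^ k] and [y ^ l] of which lie in [H], where the pairing is
trivial; by bilinearity the [k * l]-th power of the value of [chi] at that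
element is [1]. *)
Lemma heis_finite_order (C : numClosedFieldType) n (s : 'I_n.+1 -> nat)
    (H : set (heisenberg s)) (chi : heisenberg s -> C) (d : nat) :
  is_subgroup H -> is_character H chi -> irreducible (ind_rep H chi) ->
  has_dimension (ind_space H chi) d ->
  exists M, is_least_pos (fun k : nat => chi (heis_center s (s ord0)%:Z) ^+ k = 1) M.
Proof.
move=> Hgrp chi_char ind_irr Hd.
pose x : heisenberg s := Heisenberg (delta_mx 0 ord0) 0 0.
pose y : heisenberg s := Heisenberg 0 (delta_mx 0 ord0) 0.
have [k [k_gt0 Hk]] := ind_finite_dim_power x Hgrp chi_char Hd.
have [l [l_gt0 Hl]] := ind_finite_dim_power y Hgrp chi_char Hd.
have xy : heis_comm x y = (s ord0)%:Z.
  rewrite /heis_comm /= heis_form0r subr0 /heis_form (bigD1 ord0) //=.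
  rewrite big1 ?addr0 => [|j j0]; rewrite !mxE ?eqxx ?mulr1 //.
  by rewrite (negbTE j0) andbF mulr0.
have ex_k : exists m, (0 < m)%N && `[< chi (heis_center s (s ord0)%:Z) ^+ m = 1 >].
  exists (k * l)%N; rewrite muln_gt0 k_gt0 l_gt0; apply/asboolP.
  rewrite -(central_charMn Hgrp chi_char ind_irr) -xy -heis_commX.
  exact: (subgroup_perp Hgrp chi_char ind_irr _).1 Hk _ Hl.
have [M /andP[M_gt0 /asboolP psiM1] M_min] := ex_minnP ex_k.
exists M; split=> // m m_gt0 psim1; apply: M_min; rewrite m_gt0; exact/asboolP.
Qed.
End FiniteOrder.

(** * The dimension determines the order *)

Section Arithmetic.

Lemma div_gcd_gt0 (m t : nat) : 0 < m -> 0 < m %/ gcdn m t.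
Proof.
rewrite !lt0n; apply: contra_neq => q0.
by rewrite -(divnK (dvdn_gcdl m t)) q0 mul0n.
Qed.

(** The [k] with [m] dividing [k * (b / a)] are the multiples of
[m / gcd (m, b / a)]. *)
Lemma least_pos_div_gcd (m a b k : nat) :
  0 < m -> a %| b -> is_least_pos (fun k => m %| k * b %/ a) k ->
  k = m %/ gcdn m (b %/ a).
Proof.
move=> m_gt0 ab [k_gt0]; rewrite -muln_divA // dvdn_div_gcd // => q_k k_min.
have q_gt0 : 0 < m %/ gcdn m (b %/ a).
  exact: div_gcd_gt0.
apply/eqP; rewrite eqn_leq [_ <= k]dvdn_leq // andbT; apply: k_min => //.
by rewrite -muln_divA // dvdn_div_gcd.
Qed.

Lemma logn_prod (I : finType) (p : nat) (F : I -> nat) :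
  (forall i, 0 < F i) -> logn p (\prod_i F i) = \sum_i logn p (F i).
Proof.
move=> F_gt0.
suff [] : 0 < \prod_i F i /\ logn p (\prod_i F i) = \sum_i logn p (F i) by [].
elim/big_rec2: _ => [|k x y _ [y_gt0 <-]]; first by rewrite logn1.
by rewrite muln_gt0 F_gt0 y_gt0 lognM.
Qed.

(** The exponent of a prime [p] in the product is the sum of the truncated
differences between its exponents in [M] and in the [t i]: each term is
non-decreasing in the exponent of [M], and the one for [i0] is strictly
increasing. *)
Lemma prod_div_gcd_inj (I : finType) (t : I -> nat) (i0 : I) (M N : nat) :
  (forall i, 0 < t i) -> t i0 = 1 -> 0 < M -> 0 < N ->
  \prod_i (M %/ gcdn M (t i)) = \prod_i (N %/ gcdn N (t i)) -> M = N.
Proof.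
move=> t_gt0 t1 M_gt0 N_gt0 MN; apply: eqn_from_log => // p.
have logE m : 0 < m -> logn p (\prod_i (m %/ gcdn m (t i))) =
    \sum_i (logn p m - logn p (t i)).
  move=> m_gt0; rewrite logn_prod => [|i].
    apply: eq_bigr => i _; rewrite logn_div ?dvdn_gcdl // logn_gcd //.
    by rewrite minnE; lia.
  exact: div_gcd_gt0.
have lt_sum a b : a < b ->
    \sum_i (a - logn p (t i)) < \sum_i (b - logn p (t i)).
  move=> ab; rewrite (bigD1 i0) //= [X in _ < X](bigD1 i0) //= t1 logn1 !subn0.
  by rewrite -addSn leq_add // leq_sum // => i _; rewrite leq_sub2r // ltnW.
have := congr1 (logn p) MN; rewrite !logE //.
by case: (ltngtP (logn p M) (logn p N)) => // /lt_sum + E; rewrite E ltnn.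
Qed.
End Arithmetic.

Theorem theorem1p2 (R : realType) (n : nat) (s : 'I_n.+1 -> nat)
    (s_gt0 : forall j : 'I_n.+1, 0 < s j)
    (s_dvd : forall j : 'I_n.+1, s ord0 %| s j)
    (V : lmodType R[i]) (rho : representation (heisenberg s) V)
    (rho_irr : irreducible rho)
    (H : set (heisenberg s)) (chi : heisenberg s -> R[i])
    (rho_mon : monomial_wrt rho H chi)
    (N : 'I_n.+1 -> nat)
    (N0_gt0 : 0 < N ord0)
    (N_least : forall j : 'I_n.+1,
      is_least_pos (fun m : nat => N ord0 %| m * s j %/ s ord0) (N j)) :
  restriction_has_order (commutator_subgroup (heisenberg s)) chi (N ord0) <->
  has_dimension V (\prod_(j < n.+1) N j).
Proof.
have [Hgrp chi_char iso] := rho_mon.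
have ind_irr := irreducible_iso iso rho_irr.
have [phi [phi_bij _]] := iso.
have [psi [psi_bij _]] := rep_isomorphic_sym iso.
rewrite (restriction_orderE s_dvd Hgrp chi_char ind_irr).
pose dim m := \prod_j (m %/ gcdn m (s j %/ s ord0)).
have ind_dim_order m : is_least_pos
    (fun k => chi (heis_center s (s ord0)%:Z) ^+ k = 1)%R m ->
    has_dimension (ind_space H chi) (dim m).
  case: m => [[]//|m]; exact: heis_ind_dim.
have -> : \prod_j N j = dim (N ord0).
  by apply: eq_bigr => j _; apply: least_pos_div_gcd.
split=> [/ind_dim_order|/(has_dimension_iso phi_bij) Vdim].
  exact: has_dimension_iso psi_bij.
have [M psiM] := heis_finite_order Hgrp chi_char ind_irr Vdim.
have M_gt0 : 0 < M by case: psiM.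
suff <- : M = N ord0 by [].
apply: (@prod_div_gcd_inj _ (fun j => s j %/ s ord0) ord0) => // [j||].
- by rewrite divn_gt0 // dvdn_leq.
- by rewrite divnn s_gt0.
- exact: has_dimension_inj (ind_dim_order _ psiM) Vdim.
Qed.
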